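(* Let $H$ be a Hilbert space and let $R,S,T$ be three densely defined unbounded operators on $H$ with respective domains $D(R)$, $D(S)$ and $D(T)$. Assume that $$T\subset R\quad\text{and}\quad T\subset S.$$ Assume further that $R$ and $S$ are self-adjoint. Let $D\subset D(T)$ (so that $D\subset D(R)\cap D(S)$) be a dense linear subspace of $H$, and suppose that $D$ is a core for one of the two operators $R$, $S$ (for instance, for $S$). Then $R=S$.
   Context: Operators are linear and not necessarily bounded (''unbounded'' means not necessarily bounded). $T\subset R$ means that $R$ extends $T$: $D(T)\subset D(R)$ and $Tx=Rx$ for $x\in D(T)$. A linear subspace $D\subset D(A)$ is a core for a closed operator $A$ if the closure of the restriction $A|_D$ equals $A$. Equality of operators includes equality of domains. *)

(* Defs.v *)
From HB Require Import structures.
From mathcomp Require Import all_boot all_order all_algebra complex.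
From mathcomp Require Import all_classical all_reals all_analysis.

Set Implicit Arguments.
Unset Strict Implicit.
Unset Printing Implicit Defensive.

Import Order.TTheory GRing.Theory Num.Theory numFieldNormedType.Exports.

Local Open Scope classical_set_scope.
Local Open Scope ring_scope.

(* Hilbert spaces may be real or complex. *)
Variant scalar_kind := RealScalars | ComplexScalars.

Definition scalars (F : realType) (k : scalar_kind) : numFieldType :=
  match k with
  | RealScalars => F
  | ComplexScalars => F[i]
  end.

Definition scalar_conj (F : realType) (k : scalar_kind) :
    scalars F k -> scalars F k :=
  match k return scalars F k -> scalars F k with
  | RealScalars => idfun
  | ComplexScalars => @Num.conj F[i]
  end.
Arguments scalar_conj : clear implicits.

(* A complete normed space whose norm comes from an inner product, which is
   linear in its first argument and theta-semilinear in its second one; it is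
   meant to be used with (K, theta) = (scalars F k, scalar_conj F k). *)
Record hilbertType (K : numFieldType) (theta : K -> K) := HilbertType {
  hilbert_sort :> completeNormedModType K;
  inner : {dot hilbert_sort for theta};
  inner_normE : forall x : hilbert_sort, `|x| ^+ 2 = inner x x
}.

Section UnboundedOperators.
Context (K : numFieldType) (theta : K -> K) (H : hilbertType theta).

Local Notation "''[' x , y ]" := (@inner K theta H x y) : ring_scope.

Definition linear_subspace (D : set H) : Prop := submod_closed (mem D).

Record lin_subspace := LinSubspace {
  subspace_set :> set H;
  subspaceP : linear_subspace subspace_set
}.

(* The values of opfun outside of dom are irrelevant. *)
Record operator := Operator {
  dom : set H;
  opfun :> H -> H;
  dom_subspace : linear_subspace dom;
  op_linear : forall a x y, dom x -> dom y ->
    opfun (a *: x + y) = a *: opfun x + opfun y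
}.

Definition extends (R T : operator) : Prop :=
  dom T `<=` dom R /\ forall x, dom T x -> T x = R x.

Definition same_operator (A B : operator) : Prop :=
  dom A = dom B /\ forall x, dom A x -> A x = B x.

Definition graph (A : operator) : set (H * H) :=
  [set p | dom A p.1 /\ p.2 = A p.1].

Definition closed_operator (A : operator) : Prop := closed (graph A).

(* B is the closure of A. *)
Definition is_closure (A B : operator) : Prop := graph B = closure (graph A).

Lemma linear_subspaceP (D : set H) :
  linear_subspace D <->
  D 0 /\ forall a x y, D x -> D y -> D (a *: x + y).
Proof.
split=> [[/set_mem D0 Dlin]|[D0 Dlin]].
  split=> // a x y Dx Dy; apply/set_mem.
  exact: Dlin (mem_set Dx) (mem_set Dy).
split; first exact/mem_set.
by move=> a x y /set_mem Dx /set_mem Dy; apply/mem_set/Dlin.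
Qed.

Lemma linear_subspaceI (D E : set H) :
  linear_subspace D -> linear_subspace E -> linear_subspace (D `&` E).
Proof.
move=> /linear_subspaceP[D0 Dlin] /linear_subspaceP[E0 Elin].
apply/linear_subspaceP; split=> // a x y [Dx Ex] [Dy Ey].
by split; [apply: Dlin | apply: Elin].
Qed.

Section Restriction.
Variables (A : operator) (D : lin_subspace).

Lemma restriction_linear a x y :
  (dom A `&` D) x -> (dom A `&` D) y -> A (a *: x + y) = a *: A x + A y.
Proof. by move=> [Ax _] [Ay _]; apply: op_linear. Qed.

Definition restriction : operator :=
  Operator (linear_subspaceI (dom_subspace A) (subspaceP D)) restriction_linear.

End Restriction.

Definition is_core (A : operator) (D : lin_subspace) : Prop :=
  [/\ closed_operator A, D `<=` dom A & is_closure (restriction A D) A].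

Record dd_operator := DDOperator {
  dd_op :> operator;
  dd_dense : dense (dom dd_op)
}.

Lemma innerBr x y z : '[x, y - z] = '[x, y] - '[x, z].
Proof. exact: (@zmod_morphismr_subproof _ _ _ _ _ _ (inner H) x). Qed.

Lemma innerBl x y z : '[x - y, z] = '[x, z] - '[y, z].
Proof. exact: (@zmod_morphisml_subproof _ _ _ _ _ _ (inner H) z). Qed.

Lemma inner0r x : '[x, 0] = 0.
Proof. by rewrite -[X in '[_, X]](subrr 0) innerBr subrr. Qed.

Lemma innerDr x y z : '[x, y + z] = '[x, y] + '[x, z].
Proof.
by rewrite -[in LHS](opprK z) innerBr -[- z]sub0r innerBr inner0r sub0r opprK.
Qed.

Lemma innerZr a x y : '[x, a *: y] = theta a * '[x, y].
Proof. exact: (@linearr_subproof _ _ _ _ _ _ (inner H) x). Qed.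

Lemma innerC x y : '[x, y] = theta '[y, x].
Proof. by rewrite (@hermitian_subproof _ _ _ _ (inner H)) expr0 mul1r. Qed.

Lemma dense_inner_inj (D : set H) z z' :
  dense D -> (forall x, D x -> '[x, z] = '[x, z']) -> z = z'.
Proof.
move=> Dd eqz; apply/eqP; rewrite -subr_eq0; set w := z - z'.
have Dw x : D x -> '[x, w] = 0 by move=> Dx; rewrite innerBr eqz ?subrr.
have theta0 : theta 0 = 0 by rewrite -[in LHS](inner0r 0) -innerC inner0r.
apply/negPn/negP => w0; clearbody w.
have [|x [/= xw Dx]] := Dd (ball w `|w|) _ (ball_open w _).
  by exists w; apply: ballxx; rewrite normr_gt0.
move: xw; rewrite -ball_normE /= => /(ltrXn2r 2 (normr_ge0 _)).
rewrite !inner_normE innerBl !innerBr (innerC w x) (Dw x Dx) theta0 subr0 sub0r.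
by rewrite opprK gtrDl -inner_normE le_gtF ?exprn_ge0.
Qed.

(* adjoint_rel T y z says that z is a candidate for the value of T* at y. *)
Definition adjoint_rel (T : operator) (y z : H) : Prop :=
  forall x, dom T x -> '[T x, y] = '[x, z].

Section Adjoint.
Variable T : dd_operator.

Definition adjoint_dom : set H := [set y | exists z, adjoint_rel T y z].

Definition adjoint_fun (y : H) : H := xget 0 [set z | adjoint_rel T y z].

Lemma adjoint_relP y z : adjoint_rel T y z -> adjoint_fun y = z.
Proof.
move=> yz; apply: (dense_inner_inj (@dd_dense T)) => x Tx; rewrite -yz //.
by apply/esym; rewrite /adjoint_fun; case: xgetP => [_ _ -> //|/(_ z)].
Qed.

Lemma adjoint_rel_lin a y z y' z' : adjoint_rel T y z -> adjoint_rel T y' z' ->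
  adjoint_rel T (a *: y + y') (a *: z + z').
Proof. by move=> yz yz' x Tx; rewrite !(innerDr, innerZr) yz // yz'. Qed.

Lemma adjoint_dom_subspace : linear_subspace adjoint_dom.
Proof.
apply/linear_subspaceP; split; first by exists 0 => x _; rewrite !inner0r.
by move=> a y y' [z yz] [z' yz']; exists (a *: z + z'); apply: adjoint_rel_lin.
Qed.

Lemma adjoint_linear a y y' : adjoint_dom y -> adjoint_dom y' ->
  adjoint_fun (a *: y + y') = a *: adjoint_fun y + adjoint_fun y'.
Proof.
move=> [z yz] [z' yz']; rewrite (adjoint_relP yz) (adjoint_relP yz').
exact/adjoint_relP/adjoint_rel_lin.
Qed.

Definition adjoint : operator := Operator adjoint_dom_subspace adjoint_linear.

End Adjoint.

Definition self_adjoint (T : dd_operator) : Prop :=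
  same_operator T (adjoint T).

End UnboundedOperators.

(* Main.v *)
Require Import Defs.
From mathcomp Require Import all_boot all_order all_algebra complex.
From mathcomp Require Import all_classical all_reals all_analysis.

Local Open Scope classical_set_scope.

(** Suppose that D is a core for S.  On D both R and S coincide with T, so the
    graph of the restriction of S to D lies in the graph of R.  Since R is its
    own adjoint, and adjoints are closed ([adjoint_closed]), the closure of that
    restriction, which is S, is still contained in R.  A self-adjoint operator
    has no proper self-adjoint extension ([self_adjoint_maximal]), hence R = S.
    The case where D is a core for R is the same with R and S exchanged.

    The only analysis is in the closedness of adjoints: the graph of the adjoint
    is cut out by the equations <A x, y> = <x, z>, which are closed conditions
    on (y, z) because the inner product is continuous; this in turn follows from
    the Cauchy-Schwarz inequality. *)

Import Order.TTheory GRing.Theory Num.Theory numFieldNormedType.Exports.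

Section SelfAdjointExtensions.
Set Implicit Arguments.
Unset Strict Implicit.
Local Open Scope ring_scope.
Context (K : numFieldType) (theta : K -> K) (H : hilbertType theta).

Local Notation "''[' x , y ]" := (@inner K theta H x y) : ring_scope.

Lemma innerZl a (x y : H) : '[a *: x, y] = a * '[x, y].
Proof. exact: (@linearl_subproof _ _ _ _ _ _ (inner H) y). Qed.

Lemma inner0l (y : H) : '[0, y] = 0.
Proof. by rewrite -[X in '[X, _]](subrr 0) innerBl subrr. Qed.

(** Positivity of <w, w>, where w = <v, v> u - <u, v> v is <v, v> times the
    component of u orthogonal to v.  Not dividing by <v, v> avoids having to know
    how theta acts on quotients. *)
Lemma inner_mul_le (u v : H) : '[u, v] * '[v, u] <= '[v, v] * '[u, u].
Proof.
have [->|v0] := eqVneq v 0; first by rewrite !inner0l mulr0 mul0r.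
have vv0 : 0 < '[v, v] by rewrite -inner_normE exprn_gt0 ?normr_gt0.
set w := '[v, v] *: u - '[u, v] *: v.
have wv : '[w, v] = 0 by rewrite innerBl !innerZl mulrC subrr.
have : 0 <= '[w, w] by rewrite -inner_normE exprn_ge0.
rewrite {2}/w innerBr !innerZr wv mulr0 subr0 -innerC.
by rewrite (pmulr_rge0 _ vv0) innerBl !innerZl subr_ge0.
Qed.

(** The property of theta that turns <u, v> <v, u> into |<u, v>|^2; the identity
    of a real field and complex conjugation both have it. *)
Hypothesis theta_norm : forall a : K, a * theta a = `|a| ^+ 2.

Lemma inner_Cauchy_Schwarz (u v : H) : `|'[u, v]| <= `|u| * `|v|.
Proof.
rewrite -(@ler_pXn2r _ 2) ?nnegrE ?mulr_ge0// exprMn !inner_normE.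
by rewrite -theta_norm -innerC mulrC [leRHS]mulrC mulrC inner_mul_le.
Qed.

Lemma inner_continuous (x : H) : continuous (inner H x).
Proof.
move=> y; apply/cvgrPdist_lt => e e0.
have d0 : 0 < e / (`|x| + 1) by rewrite divr_gt0// ltr_wpDl.
near=> z; rewrite -innerBr; apply: (le_lt_trans (inner_Cauchy_Schwarz _ _)).
have yz : `|y - z| < e / (`|x| + 1) by near: z; apply: cvgr_dist_lt.
move: yz; rewrite ltr_pdivlMr ?ltr_wpDl// => /(le_lt_trans _); apply.
by rewrite mulrC ler_wpM2l// lerDl.
Unshelve. all: by end_near. Qed.

Lemma graph_adjoint (A : dd_operator H) :
  graph (adjoint A) = [set p | adjoint_rel A p.1 p.2].
Proof.
apply/seteqP; split=> -[y z] /=; last first.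
  by move=> yz; split; [exists z | rewrite /= (adjoint_relP yz)].
by move=> [[z' yz'] /= ->]; rewrite (adjoint_relP yz').
Qed.

(** Each x in the domain of A contributes the closed condition
    <A x, y> - <x, z> = 0 on the pairs (y, z). *)
Lemma adjoint_closed (A : dd_operator H) : closed_operator (adjoint A).
Proof.
rewrite /closed_operator graph_adjoint.
have -> : [set p | adjoint_rel A p.1 p.2] =
    \bigcap_(x in dom A) ((fun p : H * H => '[A x, p.1] - '[x, p.2]) @^-1`
                          [set 0]).
  apply/seteqP; split=> p /= + x Ax => /(_ x Ax) /=.
    by move=> ->; rewrite subrr.
  by move/subr0_eq.
apply: closed_bigI => x _; apply: preimage_closed; last first.
  exact/accessible_closed_set1/hausdorff_accessible/norm_hausdorff.
move=> p _; apply: cvgB.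
  apply: (cvg_comp fst (inner H (A x))); first exact: cvg_fst.
  exact: inner_continuous.
apply: (cvg_comp snd (inner H x)); first exact: cvg_snd.
exact: inner_continuous.
Qed.

Lemma graph_same_operator (A B : operator H) :
  same_operator A B -> graph A = graph B.
Proof.
move=> [dAB AB]; apply/seteqP; split=> -[y z] [/= Dy ->].
  by split; rewrite -?dAB//= AB.
by split; rewrite ?dAB//= AB// dAB.
Qed.

Lemma same_operator_sym (A B : operator H) :
  same_operator A B -> same_operator B A.
Proof. by move=> [dAB AB]; split=> // x; rewrite -dAB => /AB. Qed.

Lemma self_adjoint_closed (A : dd_operator H) :
  self_adjoint A -> closed_operator A.
Proof.
move=> /graph_same_operator Asa.
by rewrite /closed_operator Asa; apply: adjoint_closed.
Qed.

Lemma self_adjoint_rel (A : dd_operator H) y :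
  self_adjoint A -> dom A y -> adjoint_rel A y (A y).
Proof.
move=> Asa Ay; have : graph A (y, A y) by [].
by rewrite (graph_same_operator Asa) graph_adjoint.
Qed.

(** If A is contained in B then B* is contained in A*, that is B in A. *)
Lemma self_adjoint_maximal (A B : dd_operator H) :
  self_adjoint A -> self_adjoint B -> extends B A -> same_operator A B.
Proof.
move=> [dA _] Bsa [dAB AB]; split=> //; apply/seteqP; split=> // y By.
rewrite dA; exists (B y) => x Ax; rewrite AB//.
exact: self_adjoint_rel Bsa By x (dAB _ Ax).
Qed.

(** The graph of the restriction of A to D lies in the closed graph of B, so its
    closure, which is the graph of A, does too. *)
Lemma core_extends (A B : operator H) (D : lin_subspace H) :
  closed_operator B -> is_core A D -> D `<=` dom B ->
  (forall x, subspace_set D x -> A x = B x) -> extends B A.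
Proof.
move=> Bcl [_ _ Acl] DB AB.
have gAB : graph A `<=` graph B.
  rewrite Acl ((closure_id (graph B)).1 Bcl); apply: closure_subset => -[y z] [/= [_ Dy] ->].
  by split; [apply: DB | apply: AB].
by split=> x Ax; have [] := gAB (x, A x) (conj Ax erefl).
Qed.

Lemma self_adjoint_core_eq (A B T : dd_operator H) (D : lin_subspace H) :
  extends A T -> extends B T -> self_adjoint A -> self_adjoint B ->
  D `<=` dom T -> is_core A D -> same_operator A B.
Proof.
move=> [_ TA] [dTB TB] Asa Bsa DT Acore; apply: self_adjoint_maximal => //.
apply: core_extends Acore _ _; first exact: self_adjoint_closed.
  exact: subset_trans DT dTB.
by move=> x /DT Tx; rewrite -TA// TB.
Qed.

End SelfAdjointExtensions.

Lemma scalar_conj_norm (F : realType) (k : scalar_kind) (a : scalars F k) :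
  (a * scalar_conj F k a = `|a| ^+ 2)%R.
Proof.
case: k a => a; first by rewrite real_normK ?num_real// expr2.
exact: (esym (normCK (a : F[i]%C))).
Qed.

Theorem theorem3 (F : realType) (k : scalar_kind)
    (H : hilbertType (scalar_conj F k)) (R S T : dd_operator H)
    (hTR : extends R T) (hTS : extends S T)
    (hR : self_adjoint R) (hS : self_adjoint S)
    (D : lin_subspace H) (hDT : D `<=` dom T) (hD : dense D)
    (hcore : is_core R D \/ is_core S D) :
  same_operator R S.
Proof.
have theta_norm := @scalar_conj_norm F k.
case: hcore => [Rcore|Score].
  exact: (self_adjoint_core_eq theta_norm hTR hTS hR hS hDT Rcore).
apply: same_operator_sym; exact: (self_adjoint_core_eq theta_norm hTS hTR hS hR hDT Score).
Qed.
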